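(* For integers $m,n\geq 3$, $$mp_{f,2}(C_m\square C_n)=\begin{cases} \frac{2mn}{13} & \text{if } m,n\geq 5,\\ \frac{4n}{6} & \text{if } m=4 \text{ and } n\geq 5,\\ \frac{6n}{11} & \text{if } m=3 \text{ and } n\geq 5,\\ \frac{32}{11} & \text{if } m=n=4,\\ \frac{12}{5} & \text{if } m=4 \text{ and } n=3, \text{ and}\\ \frac{9}{5} & \text{if } m=n=3. \end{cases}$$
   Context: $C_n$ denotes the cycle on $n$ vertices and $\square$ the Cartesian product of graphs; $d$ denotes graph distance. For a finite graph $G$, the fractional $2$-limited multipacking number $mp_{f,2}(G)$ is the optimal value of the linear program: maximize $\sum_{i\in V(G)}y_i$ over real variables $(y_i)_{i\in V(G)}$ subject to $y_i\geq 0$ for every $i\in V(G)$ and $\sum_{i\in V(G):\, d(i,j)\leq \ell}y_i\leq \ell$ for every vertex $j\in V(G)$ and every $\ell\in\{1,2\}$. *)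

(* Defs.v *)
From HB Require Import structures.
From mathcomp Require Import all_boot all_order all_algebra.
From mathcomp Require Import all_classical all_reals.

Set Implicit Arguments.
Unset Strict Implicit.
Unset Printing Implicit Defensive.

Import Order.TTheory GRing.Theory Num.Theory.

Record sgraph := SGraph {
  vert :> finType;
  edge : rel vert;
  edge_sym : symmetric edge;
  edge_irr : irreflexive edge }.

Section Distance.
Variable G : sgraph.

(* k counts edges: the tuple p lists the vertices after x. *)
Definition walk (k : nat) (x y : G) : bool :=
  [exists p : k.-tuple G, path (@edge G) x p && (last x p == y)].

(* None encodes infinite distance.  A shortest walk visits no vertex twice, so
   searching lengths below #|G| is enough. *)
Definition gdist (x y : G) : option nat :=
  let k := find (fun k => walk k x y) (iota 0 #|G|) in
  if k < #|G| then Some k else None.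

Definition gdist_le (x y : G) (l : nat) : bool :=
  if gdist x y is Some k then k <= l else false.

End Distance.

Section Cycle.
Variable n : nat.

(* The conjunct x != y only matters for n = 1, where it removes the loop. *)
Definition cycle_edge : rel 'I_n := fun x y =>
  (x != y) && ((x.+1 == y %[mod n]) || (y.+1 == x %[mod n])).

Lemma cycle_edge_sym : symmetric cycle_edge.
Proof. by move=> x y; rewrite /cycle_edge eq_sym orbC. Qed.

Lemma cycle_edge_irr : irreflexive cycle_edge.
Proof. by move=> x; rewrite /cycle_edge eqxx. Qed.

Definition cycle_graph : sgraph := SGraph cycle_edge_sym cycle_edge_irr.

End Cycle.

Section CartesianProduct.
Variables G H : sgraph.

Definition cart_edge : rel (G * H)%type := fun x y =>
  ((x.1 == y.1) && edge x.2 y.2) || (edge x.1 y.1 && (x.2 == y.2)).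

Lemma cart_edge_sym : symmetric cart_edge.
Proof.
move=> x y; rewrite /cart_edge (eq_sym x.1) (eq_sym x.2).
by rewrite (edge_sym x.1) (edge_sym x.2).
Qed.

Lemma cart_edge_irr : irreflexive cart_edge.
Proof. by move=> x; rewrite /cart_edge !edge_irr andbF. Qed.

Definition cart_prod : sgraph := SGraph cart_edge_sym cart_edge_irr.

End CartesianProduct.

Section FractionalMultipacking.
Local Open Scope classical_set_scope.
Local Open Scope ring_scope.
Variables (R : realType) (G : sgraph).

Definition mpf2_feasible : set (G -> R) :=
  [set y | (forall i, 0 <= y i) /\
           (forall (j : G) (l : nat), l \in [:: 1%N; 2%N] ->
              \sum_(i | gdist_le i j l) y i <= l%:R)].

(* The feasible set contains 0 and forces y j <= 1 for every j, so this sup is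
   the genuine optimal value and not the default value of sup. *)
Definition mpf2 : R := sup [set \sum_(i : G) y i | y in mpf2_feasible].

End FractionalMultipacking.

(* Main.v *)
Require Import Defs.
From mathcomp Require Import all_boot all_order all_algebra.
From mathcomp Require Import all_classical all_reals.
From mathcomp Require Import zify ring lra.

Import Order.TTheory GRing.Theory Num.Theory.
Local Open Scope ring_scope.

(** All vertices of the torus look alike, so the linear program has a constant
    optimal solution and its value is read off the sizes of the balls.

    More precisely, let G be a graph in which all balls of radius 1 have b1
    elements and all balls of radius 2 have b2 elements.  Adding up the
    constraints of radius l over all centres counts every weight b_l times, so
    a feasible y has total weight at most l * #|G| / b_l.  Conversely, the
    constant weight min (1 / b1, 2 / b2) is feasible and attains the smaller of
    the two bounds ([mpf2_of_ball_sizes]).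

    It remains to count.  Distances in a Cartesian product add up
    ([cdist_prod_le]), so a ball of radius l in a product is a union of products
    of spheres ([card_sum_le]).  In the cycle of length k + 3 the spheres of
    radius 0, 1, 2 have 1, 2 and min (2, k) elements: two vertices at distance 2
    in general, but a single one in the 4-cycle and none in the triangle.  Thus
    a ball of the torus has 5 elements if its radius is 1 and
      (1 + 2 + min (2, n - 3)) + 2 * (1 + 2) + min (2, m - 3)
    elements if its radius is 2, which is 13, 12, 11, 11, 10, 9 in the six cases.
    The constraints of radius 2 are the binding ones except for m = n = 3, where
    1 / 5 < 2 / 9; for m = 4 and n = 3 the two bounds coincide. *)

(** * Distances up to 2 *)

Section CappedDistance.
Local Open Scope nat_scope.
Variable G : sgraph.
Implicit Types x y z : G.

(** The value 3 stands for all distances above 2: the constraints of the linear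
    program do not tell these apart. *)
Definition cdist (x y : G) : nat :=
  if x == y then 0 else if edge x y then 1
  else if [exists z, edge x z && edge z y] then 2 else 3.

Lemma walk0 x y : walk 0 x y = (x == y).
Proof.
apply/existsP/idP => [[p]|xy]; first by rewrite tuple0.
by exists [tuple].
Qed.

Lemma walk1 x y : walk 1 x y = edge x y.
Proof.
apply/existsP/idP => [[[[|z [|? ?]] //= _]]|xy].
  by rewrite andbT => /andP[xz /eqP <-].
by exists [tuple y]; rewrite /= xy eqxx.
Qed.

Lemma walk2 x y : walk 2 x y = [exists z, edge x z && edge z y].
Proof.
apply/existsP/existsP => [[[[|z [|t [|? ?]]] //= _]]|[z /andP[xz zy]]].
  by rewrite andbT => /andP[/andP[xz zt] /eqP <-]; exists z; rewrite xz zt.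
by exists [tuple z; y]; rewrite /= xz zy eqxx.
Qed.

(** A radius below the number of vertices lies within the range of lengths over
    which [gdist] searches, so the search bound has no effect. *)
Lemma gdist_le_walk x y l : l < #|G| ->
  gdist_le x y l = has (fun k => walk k x y) (iota 0 l.+1).
Proof.
move=> lG; rewrite /gdist_le /gdist.
rewrite -(minn_idPl lG) -take_iota has_take_leq ?size_iota//.
case: ltnP => // Gk; apply/esym/negbTE; rewrite -leqNgt.
exact: leq_trans Gk.
Qed.

Lemma gdist_le_cdist x y l : l <= 2 -> l < #|G| ->
  gdist_le x y l = (cdist x y <= l).
Proof.
move=> l2 lG; rewrite gdist_le_walk// /cdist.
case: l l2 {lG} => [|[|[|//]]] _ /=; rewrite walk0 ?walk1 ?walk2;
  by do ?[case: ifP => //= _].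
Qed.

Lemma cdist_sym x y : cdist x y = cdist y x.
Proof.
have sym2 : [exists z, edge x z && edge z y] = [exists z, edge y z && edge z x].
  by apply: eq_existsb => z; rewrite andbC edge_sym (edge_sym x).
by rewrite /cdist eq_sym edge_sym sym2.
Qed.

Lemma cdist_eq0 x y : (cdist x y == 0) = (x == y).
Proof.
by rewrite /cdist; case: (x == y) => //; case: (edge x y) => //; case: ifP.
Qed.

Lemma cdistxx x : cdist x x = 0.
Proof. by apply/eqP; rewrite cdist_eq0. Qed.

Lemma cdist_le1 x y : (cdist x y <= 1) = (x == y) || edge x y.
Proof.
by rewrite /cdist; case: (x == y) => //; case: (edge x y) => //; case: ifP.
Qed.

(** Capping preserves the triangle inequality: as soon as the right-hand side
    reaches 3 there is nothing to prove. *)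
Lemma cdist_triangle x y z : cdist x y <= cdist x z + cdist z y.
Proof.
have le3 : cdist x y <= 3 by rewrite /cdist; do ![case: ifP].
have [->|nxz] := eqVneq x z; first exact: leq_addl.
have [->|nzy] := eqVneq z y; first exact: leq_addr.
have pos u v : u != v -> 0 < cdist u v by rewrite lt0n cdist_eq0.
have [/andP[xz zy]|far] := boolP ((cdist x z <= 1) && (cdist z y <= 1)).
  have {}xz : edge x z by move: xz; rewrite cdist_le1 (negbTE nxz).
  have {}zy : edge z y by move: zy; rewrite cdist_le1 (negbTE nzy).
  apply: (@leq_trans 2); last by rewrite -[2]/(1 + 1) leq_add ?pos.
  have ex2 : [exists t, edge x t && edge t y].
    by apply/existsP; exists z; rewrite xz.
  by rewrite /cdist ex2; case: ifP => // _; case: ifP.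
by move: far (pos _ _ nxz) (pos _ _ nzy) le3; lia.
Qed.

Lemma cdist2_midpoint x y : cdist x y = 2 ->
  exists2 z, cdist x z <= 1 & cdist z y <= 1.
Proof.
rewrite /cdist; do 3![case: ifP => //]; move=> /existsP[z /andP[xz zy]] _ _ _.
by exists z; rewrite -/(cdist _ _) cdist_le1 ?xz ?zy orbT.
Qed.

End CappedDistance.

(** Radius 1 holds by definition of the edges of a product; radius 2 follows
    from it through midpoints, where the triangle inequality in each factor
    gives one direction, and moving in one factor at a time the other. *)
Lemma cdist_prod_le (G H : sgraph) (p q : cart_prod G H) (l : nat) :
  (l <= 2)%N ->
  (cdist _ p q <= l)%N = (cdist _ p.1 q.1 + cdist _ p.2 q.2 <= l)%N.
Proof.
have le1 (u v : cart_prod G H) :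
    (cdist _ u v <= 1)%N = (cdist _ u.1 v.1 + cdist _ u.2 v.2 <= 1)%N.
  rewrite cdist_le1 (_ : (u == v) = (u.1 == v.1) && (u.2 == v.2)) //=.
  rewrite /cart_edge /cdist.
  case: (eqVneq u.1 v.1) => [->|_]; case: (eqVneq u.2 v.2) => [->|_] /=;
    rewrite ?edge_irr ?andbF ?andbT ?orbF //=.
  - by case: edge => //; case: ifP.
  - by case: edge => //; case: ifP.
  - by do ![case: ifP => // _].
case: l => [|[|[|//]]] _; [|exact: le1|].
  by rewrite !leqn0 addn_eq0 !cdist_eq0.
apply/idP/idP => [|pq].
  rewrite leq_eqVlt => /orP[/eqP/cdist2_midpoint[z]|]; last first.
    by rewrite ltnS le1; lia.
  rewrite !le1.
  have := cdist_triangle _ p.1 q.1 z.1; have := cdist_triangle _ p.2 q.2 z.2.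
  lia.
have mid z : (cdist _ p z <= 1)%N -> (cdist _ z q <= 1)%N ->
    (cdist _ p q <= 2)%N.
  by move=> pz zq; have := cdist_triangle _ p q z; lia.
have [p1|p1] := eqVneq (cdist _ p.1 q.1) 2%N.
  have [z xz zy] := cdist2_midpoint _ _ _ p1.
  by apply: (mid (z, q.2)); rewrite le1 /= ?cdistxx ?addn0 //; lia.
have [p2|p2] := eqVneq (cdist _ p.2 q.2) 2%N.
  have [z xz zy] := cdist2_midpoint _ _ _ p2.
  by apply: (mid (q.1, z)); rewrite le1 /= ?cdistxx ?add0n //; lia.
by apply: (mid (q.1, p.2)); rewrite le1 /= ?cdistxx; lia.
Qed.

(** * The linear program on graphs with balls of constant size *)

(** Two constant dual solutions give the upper bounds: weight on the radius-1
    constraints only, or on the radius-2 constraints only.  The smaller value is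
    that of the constant primal solution.  Symmetry of the distance turns the number of balls through
    a vertex into the size of the ball around it. *)
Lemma mpf2_of_ball_sizes (R : realType) (G : sgraph) (b1 b2 : nat) :
  (2 < #|G|)%N -> (0 < b1)%N -> (0 < b2)%N ->
  (forall j : G, #|[pred i | (cdist _ i j <= 1)%N]| = b1) ->
  (forall j : G, #|[pred i | (cdist _ i j <= 2)%N]| = b2) ->
  mpf2 R G = #|G|%:R * Num.min (1 / b1%:R) (2 / b2%:R).
Proof.
move=> G_gt2 b1_gt0 b2_gt0 ball1 ball2; set c := Num.min _ _.
have distE (i j : G) l : l \in [:: 1%N; 2%N] ->
    gdist_le i j l = (cdist _ i j <= l)%N.
  by rewrite !inE => l12; apply: gdist_le_cdist; lia.
have c_ge0 : 0 <= c by rewrite le_min !divr_ge0.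
have sumc (P : pred G) : \sum_(i | P i) c = c * #|P|%:R.
  by rewrite sumr_const mulr_natr.
have double_count (b l : nat) (y : G -> R) :
    (0 < b)%N -> l \in [:: 1%N; 2%N] -> mpf2_feasible y ->
    (forall j : G, #|[pred i | (cdist _ i j <= l)%N]| = b) ->
    \sum_i y i <= #|G|%:R * (l%:R / b%:R).
  move=> b_gt0 l12 [y_ge0 yP] ball.
  rewrite mulrA ler_pdivlMr ?ltr0n // mulr_suml.
  have -> : \sum_i y i * b%:R = \sum_j \sum_(i | gdist_le i j l) y i.
    rewrite (exchange_big_dep xpredT) //=; apply: eq_bigr => i _.
    rewrite sumr_const mulr_natr; congr (_ *+ _); rewrite -(ball i).
    by apply: eq_card => j; rewrite !inE [RHS]distE // cdist_sym.
  rewrite mulrC mulr_natr -sumr_const; apply: ler_sum => j _; exact: yP.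
apply/eqP; rewrite eq_le; apply/andP; split.
  apply: ge_sup => [|_ [y yP <-]].
    exists 0, (fun=> 0); last by rewrite big1.
    by split=> // j l _; rewrite big1.
  rewrite minr_pMr // le_min; apply/andP; split.
    exact: (double_count b1 1%N).
  exact: (double_count b2 2%N).
apply: ub_le_sup.
  by exists (#|G|%:R * (1 / b1%:R)) => _ [y yP <-]; apply: (double_count b1 1%N).
exists (fun=> c); last by rewrite sumc mulrC.
split=> // j l l12; rewrite (eq_bigl _ _ (fun i => distE i j l l12)) sumc.
move: l12; rewrite !inE => /orP[] /eqP->.
  by rewrite ball1 -ler_pdivlMr ?ltr0n // ge_min lexx.
by rewrite ball2 -ler_pdivlMr ?ltr0n // ge_min lexx orbT.
Qed.

(** * Counting by level sets *)

Lemma card_le (T : finType) (f : T -> nat) (l : nat) :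
  #|[pred x | (f x <= l)%N]| = (\sum_(j < l.+1) #|[pred x | f x == j]|)%N.
Proof.
rewrite -sum1_card (partition_big (fun x => inord (f x) : 'I_l.+1) xpredT) //=.
apply: eq_bigr => j _; rewrite -sum1_card; apply: eq_bigl => x; rewrite !inE.
rewrite -val_eqE /=; apply/andP/eqP => [[fx /eqP <-]|->].
  by rewrite inordK.
by rewrite -ltnS ltn_ord inordK.
Qed.

Lemma card_sum_le (T U : finType) (f : T -> nat) (g : U -> nat) (l : nat) :
  #|[pred p : T * U | (f p.1 + g p.2 <= l)%N]| =
  (\sum_(i < l.+1) #|[pred x | f x == i]| * #|[pred y | (g y <= l - i)%N]|)%N.
Proof.
rewrite -sum1_card.
rewrite (partition_big (fun p => inord (f p.1) : 'I_l.+1) xpredT) //=.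
apply: eq_bigr => i _; rewrite -cardX -sum1_card.
apply: eq_bigl => -[x y]; rewrite !inE /= -val_eqE /=.
apply/andP/andP => [[fg /eqP <-]|[/eqP-> gy]].
  by rewrite inordK; lia.
have := ltn_ord i; rewrite inordK //; lia.
Qed.

(** * Spheres in cycles and balls in tori *)

(** The length is written k + 3 so that the vertices form the ring of integers
    modulo k + 3, in which neighbours differ by 1 or - 1. *)
Section Cycle.
Variable k : nat.
Implicit Types x y t : 'I_k.+3.
Local Notation C := (cycle_graph k.+3).

Lemma cycle_edgeE x y : edge (s := C) x y = (y - x == 1) || (y - x == -1).
Proof.
have succ (u v : 'I_k.+3) : (u.+1 == v %[mod k.+3]) = (v - u == 1).
  rewrite subr_eq -val_eqE /= eq_sym (modn_small (ltn_ord v)).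
  by rewrite !(@modn_small 1) // add1n.
rewrite /= /cycle_edge !succ.
have [->|_] /= := eqVneq x y.
  by rewrite subrr ![0 == _]eq_sym oppr_eq0 oner_eq0.
by rewrite -(opprB y) eqr_oppLR.
Qed.

Lemma cycle_two_edges x y :
  [exists z, edge (s := C) x z && edge (s := C) z y] =
  [|| y == x, y - x == 2 | y - x == -2].
Proof.
have two : 1 + 1 = 2 :> 'I_k.+3 by [].
apply/existsP/or3P => [[z]|yx].
  rewrite !cycle_edgeE => /andP[/orP[] /eqP xz /orP[] /eqP zy];
    have E : y - x = (y - z) + (z - x) by rewrite addrA subrK.
  - by apply: Or32; rewrite E xz zy.
  - by apply: Or31; rewrite -subr_eq0 E xz zy addNr.
  - by apply: Or31; rewrite -subr_eq0 E xz zy addrN.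
  - by apply: Or33; rewrite E xz zy -opprD.
case: yx => /eqP yx.
- by exists (x + 1); rewrite !cycle_edgeE yx addrC addKr opprD addNKr !eqxx orbT.
- exists (x + 1); rewrite !cycle_edgeE opprD addrA yx [x + 1]addrC addrK -two.
  by rewrite addrK eqxx.
- exists (x - 1); rewrite !cycle_edgeE opprD addrA yx [x - 1]addrC addrK -two.
  by rewrite opprK opprD addrNK eqxx orbT.
Qed.

(** The distance from 0 to t around the shorter arc, capped at 3 like
    [cdist]. *)
Definition arc_length t : nat := minn 3 (minn t (k.+3 - t)).

Lemma cycle_cdist x y : cdist C x y = arc_length (y - x).
Proof.
rewrite /cdist cycle_edgeE cycle_two_edges eq_sym -subr_eq0.
move: (y - x) => t; rewrite -!val_eqE /= !(@modn_small 1) // (@modn_small 2) //.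
rewrite !modn_small ?subn1 ?subn2 //=; try lia.
have := ltn_ord t; rewrite /arc_length.
do ![case: eqP => /=]; lia.
Qed.

Lemma card_arc_length0 : #|[pred t | arc_length t == 0%N]| = 1%N.
Proof.
rewrite -(card1 (0 : 'I_k.+3)); apply: eq_card => t.
rewrite !inE -val_eqE /= /arc_length; have := ltn_ord t; lia.
Qed.

Lemma card_arc_length1 : #|[pred t | arc_length t == 1%N]| = 2%N.
Proof.
rewrite -(_ : #|[set 1; -1 : 'I_k.+3]| = 2%N); last first.
  by rewrite cards2 -val_eqE /= !(@modn_small 1) // modn_small ?subn1.
apply: eq_card => t; rewrite !inE -!val_eqE /= /arc_length.
rewrite !(@modn_small 1) // modn_small ?subn1 //=.
have := ltn_ord t; lia.
Qed.

Lemma card_arc_length2 : #|[pred t | arc_length t == 2%N]| = minn 2%N k.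
Proof.
case: (posnP k) => [k0|k_gt0].
  (* in a triangle, 2 = - 1 and -2 = 1 are at distance 1 *)
  rewrite (_ : minn 2 k = 0%N); last by rewrite k0.
  apply: eq_card0 => t; rewrite !inE /arc_length.
  have := ltn_ord t; lia.
(* the two points coincide exactly in the 4-cycle *)
have card2 : #|[set 2; -2 : 'I_k.+3]| = minn 2%N k.
  rewrite cards2 -val_eqE /= !(@modn_small 1) // !(@modn_small 2) //.
  by rewrite modn_small; lia.
rewrite -card2; apply: eq_card => t; rewrite !inE -!val_eqE /= /arc_length.
rewrite !(@modn_small 1) // (@modn_small 2) // modn_small;
have := ltn_ord t; lia.
Qed.

Lemma card_cycle_sphere x (r : nat) :
  #|[pred y | cdist C y x == r]| = #|[pred t | arc_length t == r]|.
Proof.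
have refl_inj : injective (fun y => x - y) by move=> y z /addrI /oppr_inj.
rewrite -[RHS](on_card_preimset (f := fun y => x - y)); last first.
  by apply: onW_bij; apply: injF_bij.
by apply: eq_card => y; rewrite !inE cycle_cdist.
Qed.

End Cycle.

Section Torus.
Variables k h : nat.
Local Notation T := (cart_prod (cycle_graph k.+3) (cycle_graph h.+3)).

Lemma card_torus_ball (q : T) (l : nat) : (l <= 2)%N ->
  #|[pred p | (cdist T p q <= l)%N]| =
  (\sum_(i < l.+1) #|[pred t : 'I_k.+3 | arc_length k t == i]| *
     \sum_(j < (l - i).+1) #|[pred t : 'I_h.+3 | arc_length h t == j]|)%N.
Proof.
move=> l2.
pose f (x : cycle_graph k.+3) := cdist _ x q.1.
pose g (y : cycle_graph h.+3) := cdist _ y q.2.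
transitivity #|[pred p | (f p.1 + g p.2 <= l)%N]|.
  by apply: eq_card => p; rewrite !inE cdist_prod_le.
rewrite card_sum_le; apply: eq_bigr => i _.
rewrite card_cycle_sphere card_le; congr (_ * _)%N.
by apply: eq_bigr => j _; rewrite card_cycle_sphere.
Qed.

Lemma card_torus_ball1 (q : T) : #|[pred p | (cdist T p q <= 1)%N]| = 5%N.
Proof.
rewrite card_torus_ball // !big_ord_recl !big_ord0 /=.
by rewrite !card_arc_length0 !card_arc_length1.
Qed.

Lemma card_torus_ball2 (q : T) :
  #|[pred p | (cdist T p q <= 2)%N]| = (9 + minn 2 k + minn 2 h)%N.
Proof.
rewrite card_torus_ball // !big_ord_recl !big_ord0 /=.
rewrite !card_arc_length0 !card_arc_length1 !card_arc_length2; lia.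
Qed.

Lemma mpf2_torus (R : realType) :
  mpf2 R T = (k.+3)%:R * (h.+3)%:R *
    Num.min (1 / 5) (2 / (9 + minn 2 k + minn 2 h)%:R).
Proof.
have cardT : #|T| = (k.+3 * h.+3)%N by rewrite card_prod !card_ord.
rewrite (mpf2_of_ball_sizes R T 5 (9 + minn 2 k + minn 2 h)) //.
- by rewrite cardT natrM.
- by rewrite cardT; nia.
- exact: card_torus_ball1.
- exact: card_torus_ball2.
Qed.

End Torus.

Theorem theorem8 (R : realType) (m n : nat) (hm : (3 <= m)%N) (hn : (3 <= n)%N) :
  let mp := mpf2 R (cart_prod (cycle_graph m) (cycle_graph n)) in
  ((5 <= m)%N /\ (5 <= n)%N -> mp = 2 * m%:R * n%:R / 13) /\
  (m = 4%N /\ (5 <= n)%N -> mp = 4 * n%:R / 6) /\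
  (m = 3%N /\ (5 <= n)%N -> mp = 6 * n%:R / 11) /\
  (m = 4%N /\ n = 4%N -> mp = 32 / 11) /\
  (m = 4%N /\ n = 3%N -> mp = 12 / 5) /\
  (m = 3%N /\ n = 3%N -> mp = 9 / 5).
Proof.
case: m hm => [|[|[|k]]] // _; case: n hn => [|[|[|h]]] // _ mp.
have mpE : mp = _ := mpf2_torus k h R.
(* radius-2 balls with at least 10 elements make the radius-2 bound the lower
   one *)
have radius2 b : (9 + minn 2 k + minn 2 h)%N = b -> (10 <= b)%N ->
    mp = k.+3%:R * h.+3%:R * (2 / b%:R).
  move=> <- b_ge10; rewrite mpE; congr (_ * _); apply/min_idPr.
  rewrite ler_pdivrMr ?ltr0n //.
  have : 10 <= (9 + minn 2 k + minn 2 h)%:R :> R by rewrite ler_nat.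
  lra.
split; [|split; [|split; [|split; [|split]]]] => -[hk hh].
- by rewrite (radius2 13%N) //; [field | lia].
- by rewrite (radius2 12%N) ?hk //; [field | lia].
- by rewrite (radius2 11%N) ?hk //; [field | lia].
- by rewrite (radius2 11%N) ?hk ?hh //; [field | lia].
- by rewrite (radius2 10%N) ?hk ?hh //; [field | lia].
- have b9 : (9 + minn 2 k + minn 2 h)%N = 9%N by lia.
  by rewrite mpE b9 hk hh (min_idPl _); [field | lra].
Qed.
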